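(* Let $T$ be a continuous theory and let $T_e$ be a premetric expansion of $T$. Then $T_e$ and $T$ are $\trianglelefteq$-equivalent, i.e. $T_e\trianglelefteq T$ and $T\trianglelefteq T_e$.
   Context: A vocabulary $V$ is a countable set of constant, function and predicate symbols. A real-valued $V$-structure has a nonempty universe $M$, interpretations of constants in $M$, functions $M^n\to M$, and predicates $M^n\to[0,1]$. Continuous $V$-formulas are built from atomic formulas using continuous functions $[0,1]^n\to[0,1]$ as connectives and $\sup,\inf$ as quantifiers, with value $0$ meaning truth. A metric signature $L$ over $V$ specifies a binary predicate symbol (the distance predicate) in $V$ and a modulus of uniform continuity for each function and predicate symbol; an $L$-metric structure is a $V$-structure in which the distance predicate is a complete metric and every symbol respects its modulus. $\mathrm{Th}(\mathcal M)$ is the set of sentences with value $0$ in $\mathcal M$; a continuous theory is $\mathrm{Th}(\mathcal M)$ for a real-valued structure $\mathcal M$; an $L$-metric theory is $\mathrm{Th}(\mathcal M)$ for an $L$-metric structure; a model of $T$ is a structure in which all sentences of $T$ have value $0$. A sequence $\langle\varphi_m(\vec x,\vec y)\rangle_{m\in\mathbb N}$ of formulas is Cauchy in $\mathcal M$ if for each $\varepsilon>0$ there is $m$ such that for all $k\ge m$, $\sup_{\vec x}\sup_{\vec y}|\varphi_m-\varphi_k|\le\varepsilon$ in $\mathcal M$; then $[\lim\varphi_m]^{\mathcal M}$ denotes the pointwise limit. Premetric expansion: let $T$ be a $V$-theory, $D$ a binary predicate symbol (possibly not in $V$), $V_D=V\cup\{D\}$. A $V_D$-theory $T_e$ is a premetric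 expansion of $T$ if (i) there is a metric signature $L_e$ over $V_D$ with distance predicate $D$ such that $T_e$ is an $L_e$-metric theory, and (ii) there is a sequence $\langle d_m(x,y)\rangle$ of $V$-formulas, Cauchy in every model of $T$, such that the models of $T_e$ are exactly the $V_D$-structures $(\mathcal M,[\lim d_m]^{\mathcal M})$ with $\mathcal M$ a model of $T$. Keisler order: a structure is $\kappa$-saturated if every finitely satisfiable set of formulas with parameters from fewer than $\kappa$ elements is satisfiable (solutions give all formulas value $0$). For an ultrafilter $\mathcal D$ over $I$, the ultrapower $\mathcal M_{\mathcal D}$ has universe $M^I$ modulo indistinguishability by atomic formulas, with coordinatewise constants/functions and predicates given by $\mathcal D$-limits. $\mathcal D$ over $I$ with $|I|=\lambda$ infinite is regular if some $\mathcal X\subseteq\mathcal D$ of cardinality $\lambda$ has each $t\in I$ in only finitely many members. $\mathcal D$ saturates $\mathcal M$ if $\mathcal M_{\mathcal D}$ is $\lambda^+$-saturated; $\mathrm{Sat}(T)$ is the class of regular ultrafilters saturating every model of $T$; $T\trianglelefteq U$ means $\mathrm{Sat}(U)\subseteq\mathrm{Sat}(T)$. *)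

(* Defs.v *)
From mathcomp Require Import all_boot all_order all_algebra.
From mathcomp Require Import all_classical all_reals all_analysis.

Set Implicit Arguments.
Unset Strict Implicit.
Unset Printing Implicit Defensive.

Import Order.TTheory GRing.Theory Num.Theory.
Import numFieldNormedType.Exports.

Local Open Scope classical_set_scope.
Local Open Scope card_scope.
Local Open Scope quotient_scope.
Local Open Scope ring_scope.

(* A supply of symbols with their arities. A vocabulary is a countable set of
   symbols, so that the union of a vocabulary and a symbol makes sense whether
   or not the symbol already belongs to the vocabulary. *)
Record symbols := Symbols {
  csym : Type;
  fsym : Type;
  psym : Type;
  fsym_arity : fsym -> nat;
  psym_arity : psym -> nat }.

Record vocabulary (Sig : symbols) := Vocabulary {
  consts : set (csym Sig);
  funs : set (fsym Sig);
  preds : set (psym Sig);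
  consts_countable : countable consts;
  funs_countable : countable funs;
  preds_countable : countable preds }.

Section AddPredicate.
Variables (Sig : symbols) (V : vocabulary Sig) (D : psym Sig).

Lemma countable_add_pred : countable (preds V `|` [set D]).
Proof.
rewrite -bigcup2E; apply: bigcup_countable; first exact: countableP.
move=> [|[|n]] _ /=; [exact: preds_countable|exact: countable1|].
exact: countable0.
Qed.

Definition add_pred : vocabulary Sig :=
  @Vocabulary Sig (consts V) (funs V) (preds V `|` [set D])
    (@consts_countable Sig V) (@funs_countable Sig V) countable_add_pred.

Lemma mem_add_pred (P : preds V) : val P \in preds add_pred.
Proof. by rewrite inE; left; apply: set_mem; exact: valP. Qed.

Definition old_pred (P : preds V) : preds add_pred :=
  exist _ (val P) (mem_add_pred P).

Lemma mem_new_pred : D \in preds add_pred.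
Proof. by rewrite inE; right. Qed.

Definition new_pred : preds add_pred := exist _ D mem_new_pred.

End AddPredicate.

Section Syntax.
Variables (R : realType) (Sig : symbols) (V : vocabulary Sig).

Definition unit_cube n : set 'rV[R]_n := [set u | forall i, 0 <= u ord0 i <= 1].

(* Continuous functions from [0,1]^n to [0,1]; the values of the underlying
   function outside the cube are irrelevant. *)
Record connective n := Connective {
  conn :> 'rV[R]_n -> R;
  conn_continuous : {within @unit_cube n, continuous conn};
  conn01 : forall u, @unit_cube n u -> 0 <= conn u <= 1 }.

Inductive term :=
| Var of nat
| Cst of consts V
| App (f : funs V) of 'I_(fsym_arity (val f)) -> term.

Inductive formula :=
| Atom (P : preds V) of 'I_(psym_arity (val P)) -> term
| Conn n (c : connective n) of 'I_n -> formula
| Sup of nat & formula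
| Inf of nat & formula.

Fixpoint term_fv (t : term) : set nat :=
  match t with
  | Var x => [set x]
  | Cst _ => set0
  | App f ts => \bigcup_i term_fv (ts i)
  end.

Fixpoint fv (phi : formula) : set nat :=
  match phi with
  | Atom P ts => \bigcup_i term_fv (ts i)
  | Conn n c phis => \bigcup_i fv (phis i)
  | Sup x psi => fv psi `\ x
  | Inf x psi => fv psi `\ x
  end.

Definition sentence (phi : formula) : Prop := fv phi = set0.

End Syntax.

Section Semantics.
Variables (R : realType) (Sig : symbols) (V : vocabulary Sig).

Record structure := Structure {
  univ :> Type;
  univ_nonempty : inhabited univ;
  cst_int : consts V -> univ;
  fun_int : forall f : funs V, ('I_(fsym_arity (val f)) -> univ) -> univ;
  pred_int : forall P : preds V, ('I_(psym_arity (val P)) -> univ) -> R;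
  pred_int01 : forall P a, 0 <= @pred_int P a <= 1 }.

Definition upd (M : Type) (s : nat -> M) (x : nat) (a : M) : nat -> M :=
  fun y => if y == x then a else s y.

Fixpoint term_eval (M : structure) (s : nat -> M) (t : term V) : M :=
  match t with
  | Var x => s x
  | Cst c => cst_int M c
  | App f ts => fun_int (fun i => term_eval s (ts i))
  end.

Fixpoint eval (M : structure) (s : nat -> M) (phi : formula R V) : R :=
  match phi with
  | Atom P ts => pred_int (fun i => term_eval s (ts i))
  | Conn n c phis => c (\row_i eval s (phis i))
  | Sup x psi => sup (range (fun a : M => eval (upd s x a) psi))
  | Inf x psi => inf (range (fun a : M => eval (upd s x a) psi))
  end.

Definition theory := set (formula R V).

Definition Th (M : structure) : theory :=
  [set phi | sentence phi /\ forall s : nat -> M, eval s phi = 0].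

Definition model (T : theory) (M : structure) : Prop :=
  forall phi, T phi -> forall s : nat -> M, eval s phi = 0.

Definition continuous_theory (T : theory) : Prop :=
  exists M : structure, T = Th M.

Definition Cauchy_formulas (M : structure) (phi : nat -> formula R V) : Prop :=
  forall eps : R, 0 < eps -> exists m : nat, forall k : nat, (m <= k)%N ->
    sup (range (fun s : nat -> M => `|eval s (phi m) - eval s (phi k)|)) <= eps.

Definition lim_formulas (M : structure) (phi : nat -> formula R V)
    (s : nat -> M) : R :=
  lim ((fun m => eval s (phi m)) @ \oo).

(* A set of formulas with parameters in M: in (phi, e), the variable x of phi
   stands for the parameter a if e x = Some a, and is free if e x = None. *)
Definition pformula (M : structure) := (formula R V * (nat -> option M))%type.

Definition has_params_in (M : structure) (A : set M) (p : pformula M) : Prop :=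
  forall x a, p.2 x = Some a -> A a.

Definition peval (M : structure) (s : nat -> M) (p : pformula M) : R :=
  eval (fun x => odflt (s x) (p.2 x)) p.1.

Definition satisfiable (M : structure) (G : set (pformula M)) : Prop :=
  exists s : nat -> M, forall p, G p -> peval s p = 0.

Definition finitely_satisfiable (M : structure) (G : set (pformula M)) : Prop :=
  forall F, F `<=` G -> finite_set F -> satisfiable F.

(* |I|^+-saturation: a set has cardinality less than |I|^+ exactly when it has
   cardinality at most |I|. *)
Definition succ_saturated (I : Type) (M : structure) : Prop :=
  forall A : set M, A #<= [set: I] ->
  forall G : set (pformula M), G `<=` has_params_in A ->
    finitely_satisfiable G -> satisfiable G.

End Semantics.

Section MetricSignatures.
Variables (R : realType) (Sig : symbols) (V : vocabulary Sig).

(* The arguments a, b of a binary predicate symbol; for the dependent typing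
   they are presented as a family of arbitrary length. *)
Definition pair_args n (M : Type) (a b : M) : 'I_n -> M :=
  fun i => if i == 0%N :> nat then a else b.

Definition modulus (delta : R -> R) : Prop :=
  forall eps, 0 < eps <= 1 -> 0 < delta eps <= 1.

Record metric_signature := MetricSignature {
  dist_pred : preds V;
  dist_binary : psym_arity (val dist_pred) = 2%N;
  fun_modulus : funs V -> R -> R;
  pred_modulus : preds V -> R -> R;
  fun_modulusP : forall f, modulus (fun_modulus f);
  pred_modulusP : forall P, modulus (pred_modulus P) }.

Definition sdist (L : metric_signature) (M : structure R V) (a b : M) : R :=
  pred_int (P := dist_pred L) (pair_args a b).

Record metric_structure (L : metric_signature) (M : structure R V) : Prop := {
  sdist_eq0 : forall a b : M, sdist L a b = 0 <-> a = b;
  sdist_sym : forall a b : M, sdist L a b = sdist L b a;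
  sdist_triangle : forall a b c : M, sdist L a c <= sdist L a b + sdist L b c;
  sdist_complete : forall u : nat -> M,
    (forall eps, 0 < eps -> exists N, forall m n, (N <= m)%N -> (N <= n)%N ->
       sdist L (u m) (u n) < eps) ->
    exists l : M, forall eps, 0 < eps -> exists N, forall n, (N <= n)%N ->
      sdist L (u n) l < eps;
  fun_unif_continuous : forall (f : funs V) (a b : 'I_(fsym_arity (val f)) -> M) eps,
    0 < eps <= 1 ->
    (forall i, sdist L (a i) (b i) < fun_modulus L f eps) ->
    sdist L (fun_int a) (fun_int b) <= eps;
  pred_unif_continuous : forall (P : preds V) (a b : 'I_(psym_arity (val P)) -> M) eps,
    0 < eps <= 1 ->
    (forall i, sdist L (a i) (b i) < pred_modulus L P eps) ->
    `|pred_int a - pred_int b| <= eps }.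

Definition metric_theory (L : metric_signature) (T : theory R V) : Prop :=
  exists M : structure R V, metric_structure L M /\ T = Th M.

End MetricSignatures.

Section PremetricExpansions.
Variables (R : realType) (Sig : symbols) (V : vocabulary Sig) (D : psym Sig).

Definition reduct (N : structure R (add_pred V D)) : structure R V :=
  @Structure R Sig V N (univ_nonempty N) (cst_int N)
    (fun f => @fun_int _ _ _ N f) (fun P => @pred_int _ _ _ N (old_pred D P))
    (fun P => @pred_int01 _ _ _ N (old_pred D P)).

(* N is the structure (M, [lim d_m]^M), where M is its reduct to V; the
   variables x and y of d_m(x,y) are 0 and 1. *)
Definition is_lim_expansion (d : nat -> formula R V)
    (N : structure R (add_pred V D)) : Prop :=
  forall s : nat -> N,
    pred_int (P := new_pred V D) (pair_args (s 0%N) (s 1%N)) =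
    lim_formulas (M := reduct N) d s.

Definition premetric_expansion (T : theory R V)
    (Te : theory R (add_pred V D)) : Prop :=
  (exists L : metric_signature R (add_pred V D),
     dist_pred L = new_pred V D /\ metric_theory L Te) /\
  (exists d : nat -> formula R V,
     [/\ forall m, fv (d m) `<=` [set 0%N; 1%N],
         forall M, model T M -> Cauchy_formulas M d
       & forall N, model Te N <->
           model T (reduct N) /\ is_lim_expansion d N]).

End PremetricExpansions.

Section Ultrapowers.
Variables (R : realType) (Sig : symbols) (V : vocabulary Sig).

Definition indist (M : structure R V) (a b : M) : Prop :=
  forall (P : preds V) (ts : 'I_(psym_arity (val P)) -> term V) (x : nat)
    (s : nat -> M),
    eval (upd s x a) (Atom R ts) = eval (upd s x b) (Atom R ts).

Section Reduction.
Variable M : structure R V.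

Definition indistb (a b : {classic M}) : bool := `[< indist (M := M) a b >].

Lemma indistb_refl : reflexive indistb.
Proof. by move=> a; apply/asboolP. Qed.

Lemma indistb_sym : symmetric indistb.
Proof.
move=> a b; apply: asbool_equiv_eq.
by split=> ab P ts x s; rewrite ab.
Qed.

Lemma indistb_trans : transitive indistb.
Proof.
move=> b a c /asboolP ab /asboolP bc; apply/asboolP => P ts x s.
by rewrite ab bc.
Qed.

Definition indist_equiv : equiv_rel {classic M} :=
  EquivRel indistb indistb_refl indistb_sym indistb_trans.

Let Q := {eq_quot indist_equiv}.

Lemma reduction_nonempty : inhabited Q.
Proof. by case: (univ_nonempty M) => a; constructor; exact: (\pi_Q a). Qed.

Definition reduction : structure R V :=
  @Structure R Sig V Q reduction_nonempty
    (fun c => \pi_Q (cst_int M c))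
    (fun f a => \pi_Q (fun_int (fun i => repr (a i) : M)))
    (fun P a => pred_int (P := P) (fun i => repr (a i) : M))
    (fun P a => pred_int01 _).

End Reduction.

Record ultrafilter (I : Type) := Ultrafilter {
  ufilter : set_system I;
  ultraP : UltraFilter ufilter }.

Lemma ultra_lim01 (I : Type) (U : ultrafilter I) (r : I -> R) :
  (forall t, 0 <= r t <= 1) -> 0 <= lim (r @ ufilter U) <= 1.
Proof.
move=> r01; have UU := ultraP U.
have [p [_ clp]] : `[0, 1]%classic `&` cluster (r @ ufilter U) !=set0.
  apply: (@segment_compact R 0 1 (r @ ufilter U)).
  have rT : r @^-1` `[0, 1]%classic = setT.
    by rewrite -subTset => t _ /=; rewrite in_itv /=; apply: r01.
  by change (ufilter U (r @^-1` `[0, 1]%classic)); rewrite rT; exact: filterT.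
have rp : r @ ufilter U --> p.
  move=> B Bp; case: (in_ultra_setVsetC (r @^-1` B) UU) => // UB.
  have [q [/= nBq Bq]] := clp (~` B) B UB Bp.
  by case: nBq.
have cr : cvg (r @ ufilter U) by apply/cvg_ex; exists p.
apply/andP; split.
  by apply: limr_ge => //; apply: filterE => t; case/andP: (r01 t).
by apply: limr_le => //; apply: filterE => t; case/andP: (r01 t).
Qed.

Definition preultrapower (I : Type) (U : ultrafilter I) (M : structure R V) :
    structure R V :=
  @Structure R Sig V (I -> M)
    (let: inhabits a := univ_nonempty M in inhabits (fun=> a))
    (fun c => fun=> cst_int M c)
    (fun f a => fun t => fun_int (fun i => a i t))
    (fun P a => lim ((fun t => pred_int (P := P) (fun i => a i t)) @ ufilter U))
    (fun P a => ultra_lim01 U (fun t => pred_int01 (fun i => a i t))).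

Definition ultrapower (I : Type) (U : ultrafilter I) (M : structure R V) :
    structure R V :=
  reduction (preultrapower U M).

End Ultrapowers.

Definition regular (I : Type) (U : ultrafilter I) : Prop :=
  infinite_set [set: I] /\
  exists X : set (set I),
    [/\ forall B, X B -> ufilter U B, X #= [set: I]
      & forall t, finite_set [set B | X B /\ B t]].

Section KeislerOrder.
Variables (R : realType) (Sig : symbols).

Definition saturates (V : vocabulary Sig) (I : Type) (U : ultrafilter I)
    (M : structure R V) : Prop :=
  succ_saturated I (ultrapower U M).

Definition Sat (V : vocabulary Sig) (T : theory R V) (I : Type) :
    set (ultrafilter I) :=
  [set U | regular U /\ forall M, model T M -> saturates U M].

Definition keisler_le (V W : vocabulary Sig) (T : theory R V) (U : theory R W) :
    Prop :=
  forall I : Type, Sat U (I := I) `<=` Sat T (I := I).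

End KeislerOrder.

Notation "T ⊴ U" := (keisler_le T U) (at level 70).

(* Main.v *)
(* Saturation of an ultrapower may be tested on the preultrapower, whose formulas
   take limits along U of their coordinatewise values (Los). The preultrapower P
   of a model of T_e is again a model of T_e, so D is the uniform limit of the
   d_m in P and every V_D-formula is a uniform limit of V-formulas there. Hence a
   set of V_D-conditions [phi = 0] is equivalent to the set of V-conditions
   [|phi_n| <= 1/n] with [phi_n] within [1/n] of [phi], and P is saturated as soon
   as its V-reduct is; the converse is clear. Finally every model M of T is the
   reduct of a model of T_e: when D is in V this uses that T is complete, so that
   M satisfies the sentences expressing that the d_m converge uniformly to D. *)
From mathcomp Require Import all_boot all_order all_algebra.
From mathcomp Require Import all_classical all_reals all_analysis.
From mathcomp Require Import lra.
(* Imported last: mathcomp-analysis also has an [eval]. *)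
Require Import Defs.

Set Implicit Arguments.
Unset Strict Implicit.
Unset Printing Implicit Defensive.

Import Order.TTheory GRing.Theory Num.Theory.
Import numFieldNormedType.Exports.

Local Open Scope classical_set_scope.
Local Open Scope card_scope.
Local Open Scope quotient_scope.
Local Open Scope ring_scope.

(** * Bounded real functions: uniform continuity on the cube, ultrafilter limits, suprema and
    infima *)

Section Bounded.
Variable R : realType.

Lemma rV_distP n (u v : 'rV[R]_n) (e : R) : 0 < e ->
  `|u - v| < e <-> forall i, `|u ord0 i - v ord0 i| < e.
Proof.
move=> e0; rewrite -[X in X < _]/(mx_norm _) mx_normrE; split=> [/bigmax_ltP[_ H] i|H].
  by have := H (ord0, i) isT; rewrite !mxE.
apply/bigmax_ltP; split=> // -[i j] _ /=.
by rewrite !mxE ord1; apply: H.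
Qed.

Lemma compact_unit_cube n : compact (@unit_cube R n).
Proof.
rewrite (_ : @unit_cube R n = [set u | forall i, `[0, 1]%classic (u ord0 i)]).
  by apply: (@rV_compact R n (fun=> `[0, 1]%classic)) => i; exact: segment_compact.
by apply/seteqP; split=> u H i; have := H i; rewrite /= in_itv.
Qed.

(** Heine-Cantor: compactness of the cube, in its near-covering form, turns the local radii into a
    single [d]. *)
Lemma conn_unif_continuous n (c : connective R n) (e : R) : 0 < e ->
  exists2 d, 0 < d & forall u v, unit_cube u -> unit_cube v ->
    (forall i, `|u ord0 i - v ord0 i| < d) -> `|c u - c v| < e.
Proof.
move=> e0.
pose P (d : R) u := forall v, unit_cube u -> unit_cube v ->
    `|u - v| < d -> `|c u - c v| < e.
have /compact_near_coveringP K := @compact_unit_cube n.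
have : \forall d \near 0^'+, @unit_cube R n `<=` P d.
  apply: K => x Kx.
  have /subspace_continuousP/(_ x Kx)/cvgrPdist_lt/(_ (e / 2)) := @conn_continuous R n c.
  move=> /(_ (divr_gt0 e0 (ltr0Sn _ _))); rewrite near_withinE => /nbhs_normP[r /= r0 Hr].
  have r20 : 0 < r / 2 by rewrite divr_gt0.
  near=> u d => v Ku Kv uv.
  have xu : `|x - u| < r / 2 by near: u; exact: cvgr_dist_lt.
  have dr : d < r / 2 by near: d; exact: nbhs_right_lt.
  have cu : `|c x - c u| < e / 2.
    by apply: Hr => //=; apply: lt_trans xu _; lra.
  have cv : `|c x - c v| < e / 2.
    apply: Hr => //=; apply: le_lt_trans (ler_distD u x v) _.
    by rewrite [r]splitr ltrD // (lt_trans uv dr).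
  apply: le_lt_trans (ler_distD (c x) (c u) (c v)) _.
  by rewrite [e]splitr ltrD // distrC.
move=> [d /= d0 Hd]; have d20 : 0 < d / 2 by rewrite divr_gt0.
exists (d / 2) => // u v Ku Kv /rV_distP uv.
apply: (Hd (d / 2)) => //=; last exact: uv.
by rewrite sub0r normrN gtr0_norm //; lra.
Unshelve. all: by end_near. Qed.

(** Compactness of [-1, 1] gives a cluster point, and an ultrafilter converges to each of its
    cluster points. *)
Lemma ultra_cvg (I : Type) (U : ultrafilter I) (r : I -> R) :
  (forall t, `|r t| <= 1) -> exists p : R, r @ ufilter U --> p.
Proof.
move=> r1; have UU := ultraP U.
have [p [_ clp]] : `[-1, 1]%classic `&` cluster (r @ ufilter U) !=set0.
  apply: (@segment_compact R (-1) 1 (r @ ufilter U)).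
  suff : \forall t \near ufilter U, `[-1, 1]%classic (r t) by [].
  by apply: filterE => t /=; rewrite in_itv /= -ler_norml.
exists p => B Bp; case: (in_ultra_setVsetC (r @^-1` B) UU) => // UB.
by have [q [/= nBq Bq]] := clp (~` B) B UB Bp.
Qed.

Lemma range_neq0 T (f : T -> R) : inhabited T -> range f !=set0.
Proof. by case=> a; exists (f a), a. Qed.

Lemma has_ubound_range T (f : T -> R) :
  (forall a, `|f a| <= 1) -> has_ubound (range f).
Proof. by move=> f1; exists 1 => _ [a _ <-]; exact: ler_normlW. Qed.

Lemma le_sup_range T (f : T -> R) a :
  (forall a, `|f a| <= 1) -> f a <= sup (range f).
Proof. by move=> f1; apply: ub_le_sup; [exact: has_ubound_range|exists a]. Qed.

Lemma sup_range_le T (f : T -> R) x : inhabited T ->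
  (forall a, f a <= x) -> sup (range f) <= x.
Proof.
by move=> T0 fx; apply: ge_sup; [exact: range_neq0|move=> _ [a _ <-]].
Qed.

Lemma sup_range_norm T (f : T -> R) : inhabited T ->
  (forall a, `|f a| <= 1) -> `|sup (range f)| <= 1.
Proof.
move=> T0 f1; rewrite ler_norml sup_range_le ?andbT//; last first.
  by move=> a; exact: ler_normlW.
case: (T0) => a; apply: le_trans (le_sup_range a f1).
by have := f1 a; rewrite ler_norml => /andP[].
Qed.

Lemma sup_range_leD T (f g : T -> R) e : inhabited T ->
  (forall a, `|g a| <= 1) -> (forall a, f a <= g a + e) ->
  sup (range f) <= sup (range g) + e.
Proof.
move=> T0 g1 fg; apply: sup_range_le => // a; apply: le_trans (fg a) _.
by rewrite lerD2r le_sup_range.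
Qed.

Lemma sup_range_dist T (f g : T -> R) e : inhabited T ->
  (forall a, `|f a| <= 1) -> (forall a, `|g a| <= 1) ->
  (forall a, `|f a - g a| <= e) -> `|sup (range f) - sup (range g)| <= e.
Proof.
move=> T0 f1 g1 fg.
have H1 : sup (range f) <= sup (range g) + e.
  by apply: sup_range_leD => // a; have := fg a; rewrite ler_distl; lra.
have H2 : sup (range g) <= sup (range f) + e.
  by apply: sup_range_leD => // a; have := fg a; rewrite ler_distl; lra.
by rewrite ler_distl; lra.
Qed.

Lemma inf_rangeE T (f : T -> R) : inf (range f) = - sup (range (fun a => - f a)).
Proof. by rewrite /inf image_comp. Qed.

Lemma inf_range_dist T (f g : T -> R) e : inhabited T ->
  (forall a, `|f a| <= 1) -> (forall a, `|g a| <= 1) ->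
  (forall a, `|f a - g a| <= e) -> `|inf (range f) - inf (range g)| <= e.
Proof.
move=> T0 f1 g1 fg; rewrite !inf_rangeE -opprD normrN.
apply: sup_range_dist => // a; rewrite ?normrN// -opprD normrN; exact: fg.

Qed.

(** Limits along [U] commute with suprema because near-maximal points can be picked independently at
    each index, and the resulting choice function is itself a point of [I -> M]. *)
Lemma ultra_sup (I : Type) (U : ultrafilter I) (M : Type)
    (g : I -> M -> R) (G : (I -> M) -> R) : inhabited M ->
  (forall t b, `|g t b| <= 1) ->
  (forall a, (fun t => g t (a t)) @ ufilter U --> G a) ->
  (fun t => sup (range (g t))) @ ufilter U --> sup (range G).
Proof.
move=> M0 g1 gG; have UU := ultraP U.
have IM0 : inhabited (I -> M) by case: M0 => b; constructor; exact: (fun=> b).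
have G1 a : `|G a| <= 1.
  rewrite ler_norml; apply/andP; split.
    apply: (cvgr_to_ge (gG a)); apply: filterE => t.
    by have := g1 t (a t); rewrite ler_norml => /andP[].
  by apply: (cvgr_to_le (gG a)); apply: filterE => t; exact: ler_normlW.
have [L supL] := ultra_cvg U (fun t => sup_range_norm M0 (g1 t)).
suff -> : sup (range G) = L by [].
apply/eqP; rewrite eq_le; apply/andP; split.
  apply: sup_range_le => // a.
  rewrite -subr_ge0; apply: (cvgr_to_ge (cvgB supL (gG a))).
  by apply: filterE => t; rewrite /= subr_ge0 le_sup_range.
apply/ler_addgt0Pr => e e0.
(* [a] comes within [e] of the supremum at every index, so [G a] comes within [e] of [L]. *)
have /choice[a aP] t : exists b, sup (range (g t)) - e < g t b.
  have [|_ [b _ <-] gb] := @sup_adherent R (range (g t)) e e0; last by exists b.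
  by split; [exact: range_neq0|exact: has_ubound_range].
have : L - G a <= e.
  apply: (cvgr_to_le (cvgB supL (gG a))); apply: filterE => t /=.
  by rewrite !fctE lerBlDr -lerBlDl; exact/ltW/aP.
by have := le_sup_range a G1; lra.
Qed.

Lemma ultra_inf (I : Type) (U : ultrafilter I) (M : Type)
    (g : I -> M -> R) (G : (I -> M) -> R) : inhabited M ->
  (forall t b, `|g t b| <= 1) ->
  (forall a, (fun t => g t (a t)) @ ufilter U --> G a) ->
  (fun t => inf (range (g t))) @ ufilter U --> inf (range G).
Proof.
move=> M0 g1 gG; have UU := ultraP U.
rewrite inf_rangeE (_ : (fun t => _) = fun t => - sup (range (fun b => - g t b))).
  apply: cvgN; apply: ultra_sup => // [t b|a]; first by rewrite normrN.
  exact: cvgN.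
by apply/funext => t; rewrite inf_rangeE.
Qed.

End Bounded.

(** * Values of formulas: bounds, dependence on free variables, substitution *)

Section Evaluation.
Variables (R : realType) (Sig : symbols) (V : vocabulary Sig).
Implicit Types (M : structure R V) (phi : formula R V) (t : term V).

Lemma unit_cube_row n (f : 'I_n -> R) :
  (forall i, 0 <= f i <= 1) -> unit_cube (\row_i f i).
Proof. by move=> f01 i; rewrite mxE. Qed.

Lemma norm_le1 (r : R) : 0 <= r <= 1 -> `|r| <= 1.
Proof. by move=> /andP[r0 r1]; rewrite ger0_norm. Qed.

(** This also ensures that every [sup] and [inf] in [eval] is taken over a bounded nonempty set. *)
Lemma eval01 M (s : nat -> M) phi : 0 <= eval s phi <= 1.
Proof.
have M0 := univ_nonempty M.
elim: phi s => [P ts|n c phis IH|x psi IH|x psi IH] s /=.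
- exact: pred_int01.
- by apply: conn01; apply: unit_cube_row => i; exact: IH.
- apply/andP; split; last by apply: sup_range_le => // a; case/andP: (IH (upd s x a)).
  case: (M0) => a; apply: (@le_trans _ _ (eval (upd s x a) psi)).
    by case/andP: (IH (upd s x a)).
  by apply: (le_sup_range (f := fun a => eval (upd s x a) psi)) => b; exact: norm_le1.
- rewrite inf_rangeE oppr_ge0 lerNl; apply/andP; split.
    by apply: sup_range_le => // a; rewrite oppr_le0; case/andP: (IH (upd s x a)).
  case: (M0) => a; apply: (@le_trans _ _ (- eval (upd s x a) psi)).
    by rewrite lerN2; case/andP: (IH (upd s x a)).
  apply: (le_sup_range (f := fun a => - eval (upd s x a) psi)) => b.
  by rewrite normrN; exact: norm_le1.
Qed.

Lemma eval_norm M (s : nat -> M) phi : `|eval s phi| <= 1.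
Proof. exact/norm_le1/eval01. Qed.

Lemma term_eval_fv M (s s' : nat -> M) t :
  (forall x, term_fv t x -> s x = s' x) -> term_eval s t = term_eval s' t.
Proof.
elim: t => [x|c|f ts IH] //= ss'; first exact: ss'.
by congr fun_int; apply/funext => i; apply: IH => x tx; apply: ss'; exists i => //.
Qed.

Lemma eval_fv M (s s' : nat -> M) phi :
  (forall x, fv phi x -> s x = s' x) -> eval s phi = eval s' phi.
Proof.
elim: phi s s' => [P ts|n c phis IH|x psi IH|x psi IH] s s' /= ss'.
- congr pred_int; apply/funext => i; apply: term_eval_fv => x tx.
  by apply: ss'; exists i => //.
- congr (conn c _); apply/rowP => i; rewrite !mxE; apply: IH => x px.
  by apply: ss'; exists i => //.
- congr (sup (_ @` _)); apply/funext => a; apply: IH => y py; rewrite /upd.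
  by case: eqP => // /eqP yx; apply: ss'; split=> //; exact/eqP.
- congr (inf (_ @` _)); apply/funext => a; apply: IH => y py; rewrite /upd.
  by case: eqP => // /eqP yx; apply: ss'; split=> //; exact/eqP.
Qed.

Lemma finite_term_fv t : finite_set (term_fv t).
Proof.
elim: t => [x|c|f ts IH] /=; [exact: finite_set1|exact: finite_set0|].
by apply: bigcup_finite => [|i _]; [exact: finite_finset|exact: IH].
Qed.

Lemma finite_fv phi : finite_set (fv phi).
Proof.
elim: phi => [P ts|n c phis IH|x psi IH|x psi IH] /=; last 2 first.
- exact: finite_setD.
- exact: finite_setD.
- by apply: bigcup_finite => [|i _]; [exact: finite_finset|exact: finite_term_fv].
- by apply: bigcup_finite => [|i _]; [exact: finite_finset|exact: IH].
Qed.

Fixpoint term_subst (sigma : nat -> term V) t : term V :=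
  match t with
  | Var x => sigma x
  | Cst c => Cst c
  | App f ts => App (fun i => term_subst sigma (ts i))
  end.

Lemma term_eval_subst M (s : nat -> M) sigma t :
  term_eval s (term_subst sigma t) = term_eval (fun x => term_eval s (sigma x)) t.
Proof.
elim: t => [x|c|f ts IH] //=.
by congr fun_int; apply/funext => i; exact: IH.
Qed.

Lemma fresh_var (F : set nat) : finite_set F -> exists z, ~ F z.
Proof.
move=> Ffin; apply: contrapT => /forallNP FT; apply: infinite_nat.
by rewrite (_ : [set: nat] = F) // eqEsubset; split=> // z _; exact: contrapT.
Qed.

(* Capture of free variables is avoided by renaming each bound variable. *)
Lemma formula_subst phi (sigma : nat -> term V) : exists phi', forall M (s : nat -> M),
  eval s phi' = eval (fun x => term_eval s (sigma x)) phi.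
Proof.
(* [z] avoids the variables of all terms substituted for free variables of [psi]; these are finitely
   many, so such a [z] exists. *)
have bound x (psi : formula R V) (sigma' : nat -> term V) : exists z,
    forall (M : structure R V) (s : nat -> M) a,
    (forall y, fv psi y -> term_eval (upd s z a) (upd sigma' x (Var V z) y)
      = upd (fun y => term_eval s (sigma' y)) x a y).
  have [|z zF] := @fresh_var (\bigcup_(y in fv psi) term_fv (sigma' y)).
    by apply: bigcup_finite => [|y _]; [exact: finite_fv|exact: finite_term_fv].
  exists z => M s a y py; rewrite /upd; case: (y =P x) => [yx|_] /=.
    by rewrite eqxx.
  apply: term_eval_fv => w wy; case: eqP => // wz.
  by case: zF; exists y => //; rewrite -wz.
elim: phi sigma => [P ts|n c phis IH|x psi IH|x psi IH] sigma.
- exists (Atom R (fun i => term_subst sigma (ts i))) => M s /=.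
  by congr pred_int; apply/funext => i; exact: term_eval_subst.
- have /choice[phis' Hphis] i := IH i sigma.
  exists (Conn c phis') => M s /=; congr (conn c _); apply/rowP => i.
  by rewrite !mxE.
- have [z Hz] := bound x psi sigma; have [psi' Hpsi] := IH (upd sigma x (Var V z)).
  exists (Sup z psi') => M s /=; congr (sup (_ @` _)); apply/funext => a.
  by rewrite Hpsi; apply: eval_fv; exact: Hz.
- have [z Hz] := bound x psi sigma; have [psi' Hpsi] := IH (upd sigma x (Var V z)).
  exists (Inf z psi') => M s /=; congr (inf (_ @` _)); apply/funext => a.
  by rewrite Hpsi; apply: eval_fv; exact: Hz.
Qed.

End Evaluation.

(** * Approximate equality as a condition of value zero *)

Section Connectives.
Variables (R : realType) (Sig : symbols) (V : vocabulary Sig).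

(** Truncation to [0, 1] turns an inequality [r <= 0] into the equation [clamp r = 0] between
    admissible truth values. *)
Definition clamp (r : R) : R := Num.max 0 (Num.min 1 r).

Lemma clamp01 r : 0 <= clamp r <= 1.
Proof. by rewrite /clamp le_max lexx ge_max ler01 ge_min lexx. Qed.

Lemma clamp_eq0 r : clamp r = 0 <-> r <= 0.
Proof.
rewrite /clamp; split=> [/eqP|r0]; last by rewrite max_l // ge_min r0 orbT.
by rewrite eq_maxl ge_min ler10 orFb.
Qed.

Lemma clamp_continuous n (f : 'rV[R]_n -> R) : continuous f ->
  {within @unit_cube R n, continuous (fun u => clamp (f u))}.
Proof.
move=> cf; apply: continuous_subspaceT.
have cmin := @min_fun_continuous _ _ (R : orderTopologicalType _)
  (cst 1) f (@cst_continuous _ _ (1 : R)) cf.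
exact: (@max_fun_continuous _ _ (R : orderTopologicalType _)
  (cst 0) (cst 1 \min f) (@cst_continuous _ _ (0 : R)) cmin).
Qed.

Definition clamp_conn n (f : 'rV[R]_n -> R) (cf : continuous f) : connective R n :=
  Connective (clamp_continuous cf) (fun u _ => clamp01 (f u)).

Lemma dist_continuous n (f g : 'rV[R]_n -> R) (e : R) :
  continuous f -> continuous g -> continuous (fun u => `|f u - g u| - e).
Proof.
move=> cf cg u.
have cfg := continuousB (cf u) (cg u).
have cn := continuous_comp cfg (@norm_continuous _ R^o _).
exact: (continuousB cn (@cst_continuous _ _ e _)).
Qed.

Lemma near_cst_continuous (e r : R) :
  continuous (fun u : 'rV[R]_1 => `|u ord0 ord0 - r| - e).
Proof.
apply: (dist_continuous (g := cst r)); [exact: coord_continuous|exact: cst_continuous].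
Qed.

Lemma near_continuous (e : R) :
  continuous (fun u : 'rV[R]_2 => `|u ord0 ord0 - u ord0 ord_max| - e).
Proof. by apply: dist_continuous; exact: coord_continuous. Qed.

Definition near_cst_formula e r (phi : formula R V) : formula R V :=
  Conn (clamp_conn (@near_cst_continuous e r)) (fun=> phi).

Definition near_formula e (phi psi : formula R V) : formula R V :=
  Conn (clamp_conn (@near_continuous e)) (fun i => if i == ord0 then phi else psi).

Lemma eval_near_cst (M : structure R V) (s : nat -> M) e r phi :
  eval s (near_cst_formula e r phi) = 0 <-> `|eval s phi - r| <= e.
Proof. by rewrite /= clamp_eq0 !mxE subr_le0. Qed.

Lemma eval_near (M : structure R V) (s : nat -> M) e phi psi :
  eval s (near_formula e phi psi) = 0 <-> `|eval s phi - eval s psi| <= e.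
Proof. by rewrite /= clamp_eq0 !mxE subr_le0. Qed.

End Connectives.

(** * The theorem of Los for preultrapowers *)

Section Los.
Variables (R : realType) (Sig : symbols) (V : vocabulary Sig).
Variables (I : Type) (U : ultrafilter I) (M : structure R V).
Let P := preultrapower U M.

Lemma term_eval_preultrapower (s : nat -> P) t i :
  term_eval s t i = term_eval (fun x => s x i : M) t.
Proof.
elim: t => [x|c|f ts IH] //=.
by congr fun_int; apply/funext => j; exact: IH.
Qed.

(** Atoms hold by construction, connectives by uniform continuity, quantifiers by [ultra_sup] and
    [ultra_inf], since the universe of the preultrapower consists of all functions [I -> M]. *)
Lemma los (s : nat -> P) phi :
  (fun i => eval (fun x => s x i : M) phi) @ ufilter U --> eval s phi.
Proof.
have UU := ultraP U; have M0 := univ_nonempty M.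
have updE (s' : nat -> P) x a i :
    (fun y => upd s' x a y i : M) = upd (fun y => s' y i : M) x (a i).
  by apply/funext => y; rewrite /upd; case: eqP.
elim: phi s => [Q ts|n c phis IH|x psi IH|x psi IH] s /=.
- have [p cp] := @ultra_cvg R I U
    (fun t => pred_int (P := Q) (fun i => term_eval s (ts i) t)) (fun=> norm_le1 (pred_int01 _)).
  rewrite (cvg_lim _ cp) //.
  suff -> : (fun i => pred_int (P := Q) (fun j => term_eval (fun x => s x i : M) (ts j))) =
    (fun t => pred_int (P := Q) (fun i => term_eval s (ts i) t)) by [].
  apply/funext => t; congr pred_int; apply/funext => i.
  by rewrite term_eval_preultrapower.
- apply/cvgrPdist_lt => e e0; have [d d0 cd] := conn_unif_continuous c e0.
  (* A connective has finitely many arguments, so all of them are close on one set of the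
     ultrafilter. *)
  have : \forall t \near ufilter U, forall i,
      `|eval s (phis i) - eval (fun x => s x t : M) (phis i)| < d.
    apply: filter_forall => i; have /cvgrPdist_lt := IH i s; exact.
  apply: filterS => t Ht; apply: cd => [||i].
  + by apply: unit_cube_row => i; exact: eval01.
  + by apply: unit_cube_row => i; exact: eval01.
  + by rewrite !mxE.
- apply: (ultra_sup (g := fun t b => eval (upd (fun y => s y t : M) x b) psi)) => //.
    by move=> t b; exact: eval_norm.
  move=> a; have := IH (upd s x a).
  by under eq_fun do rewrite updE.
- apply: (ultra_inf (g := fun t b => eval (upd (fun y => s y t : M) x b) psi)) => //.
    by move=> t b; exact: eval_norm.
  move=> a; have := IH (upd s x a).
  by under eq_fun do rewrite updE.
Qed.

Lemma model_preultrapower (T : theory R V) : model T M -> model T P.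
Proof.
move=> TM phi Tphi s; have UU := ultraP U.
have := los (s := s) (phi := phi).
rewrite (_ : (fun i => _) = cst 0); last by apply/funext => i; exact: TM.
by move=> /cvg_lim <- //; rewrite lim_cst.
Qed.

End Los.

(** * Passing to the quotient by indistinguishability preserves all values *)

Section Reduction.
Variables (R : realType) (Sig : symbols) (V : vocabulary Sig) (M : structure R V).
Let Q := reduction M.

Definition red (a : M) : Q := \pi_{eq_quot (indist_equiv M)} (a : {classic M}).
Definition unred (q : Q) : M := repr (q : {eq_quot (indist_equiv M)}).

Lemma unredK q : red (unred q) = q.
Proof. exact: reprK. Qed.

Lemma red_indist a : indist (unred (red a)) a.
Proof.
have /eqmodP/asboolP : red (unred (red a)) = red a := unredK (red a).
by [].
Qed.

(** [indist] allows one variable to change at a time; an atomic formula has finitely many variables,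
    so finitely many changes lead from [s] to [s']. *)
Lemma atom_indist (s s' : nat -> M) (P : preds V) (ts : 'I_(psym_arity (val P)) -> term V) :
  (forall x, indist (s x) (s' x)) -> eval s (Atom R ts) = eval s' (Atom R ts).
Proof.
move=> ss'.
(* [mix n] has already switched to [s'] on the variables below [n]; the next step changes only
   variable [n]. *)
pose mix n x := if (x < n)%N then s' x else s x.
have mixE n : eval (mix n) (Atom R ts) = eval s (Atom R ts).
  elim: n => // n <-.
  have -> : mix n.+1 = upd (mix n) n (s' n).
    apply/funext => x; rewrite /mix /upd ltnS leq_eqVlt.
    by case: eqP => [->|].
  rewrite -(ss' n); congr eval; apply/funext => x; rewrite /mix /upd.
  by case: eqP => [->|//]; rewrite ltnn.
have [n Hn] : exists n, forall x, fv (Atom R ts) x -> (x < n)%N.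
  have /finite_seqP[l lE] := finite_fv (Atom R ts).
  exists (\max_(x <- l) x).+1 => x; rewrite lE /= ltnS => xl.
  by apply: (@leq_bigmax_seq _ _ xpredT id).
by rewrite -(mixE n); apply: eval_fv => x /Hn; rewrite /mix => ->.
Qed.

(* An atomic formula evaluated at [f b] is a substitution instance evaluated
   at [b]; its variables are shifted by the arity of [f] to make room for [b]. *)
Lemma fun_indist (f : funs V) (a b : 'I_(fsym_arity (val f)) -> M) :
  (forall i, indist (a i) (b i)) -> indist (fun_int a) (fun_int b).
Proof.
move=> ab P ts x s; set n := fsym_arity (val f) in a b ab *.
pose sh (c : 'I_n -> M) y := if insub y is Some i then c i else s (y - n)%N.
pose sigma := upd (fun y => Var V (y + n)) x (App (fun i : 'I_n => Var V i)).
have shE c : eval (upd s x (fun_int c)) (Atom R ts) =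
    eval (sh c) (Atom R (fun i => term_subst sigma (ts i))).
  rewrite /=; congr pred_int; apply/funext => i; rewrite term_eval_subst.
  congr term_eval; apply/funext => y; rewrite /upd /sigma /upd; case: eqP => _ /=.
    by congr fun_int; apply/funext => j; rewrite /sh valK.
  by rewrite /sh insubF ?addnK // ltnNge leq_addl.
rewrite !shE; apply: atom_indist => y; rewrite /sh; case: insubP => //.
Qed.

Lemma term_eval_red (s : nat -> M) t :
  term_eval (M := Q) (fun x => red (s x)) t = red (term_eval s t).
Proof.
elim: t => [x|c|f ts IH] //=.
apply/eqmodP/asboolP; apply: fun_indist => i.
by rewrite IH; exact: red_indist.
Qed.

(** [pred_int c] is the value of an atom in the variables below [n] at the assignment [sh c]; the
    default [m] fills the later variables. *)
Lemma pred_indist (P : preds V) (a b : 'I_(psym_arity (val P)) -> M) :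
  (forall i, indist (a i) (b i)) -> pred_int a = pred_int b.
Proof.
move=> ab; have [m] := univ_nonempty M; set n := psym_arity (val P) in a b ab *.
pose sh (c : 'I_n -> M) y := if insub y is Some i then c i else m.
have shE c : pred_int c = eval (sh c) (Atom R (fun i : 'I_n => Var V i)).
  by rewrite /=; congr pred_int; apply/funext => j; rewrite /sh valK.
by rewrite !shE; apply: atom_indist => y; rewrite /sh; case: insubP => //.
Qed.

Lemma range_red (f : Q -> R) (g : M -> R) :
  (forall a, f (red a) = g a) -> range f = range g.
Proof.
move=> fg; apply/seteqP; split=> _ [a _ <-]; last by exists (red a).
by exists (unred a) => //; rewrite -fg unredK.
Qed.

(** Functions and predicates respect indistinguishability, and [red] is onto, so quantifiers range
    over the same values on both sides. *)
Lemma eval_red (s : nat -> M) phi :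
  eval (M := Q) (fun x => red (s x)) phi = eval s phi.
Proof.
have updE s' x a : upd (fun y => red (s' y)) x (red a) = fun y => red (upd s' x a y).
  by apply/funext => y; rewrite /upd; case: eqP.
elim: phi s => [P ts|n c phis IH|x psi IH|x psi IH] s /=.
- by apply: pred_indist => i; rewrite term_eval_red; exact: red_indist.
- by congr (conn c _); apply/rowP => i; rewrite !mxE.
- by congr sup; apply: range_red => a; rewrite updE.
- by congr inf; apply: range_red => a; rewrite updE.
Qed.

End Reduction.

(** * Transfer of saturation between structures, possibly over different vocabularies *)

Section SaturationTransfer.
Variables (R : realType) (Sig : symbols) (V W : vocabulary Sig).

(* [E] is a correspondence between the universes under which every W-formula
   is a uniform limit of V-formulas. *)
Lemma succ_saturated_transfer (I : Type) (M : structure R V) (N : structure R W)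
    (E : M -> N -> Prop) :
  (forall a, exists b, E a b) -> (forall b, exists a, E a b) ->
  (forall (phi : formula R W) (e : R), 0 < e -> exists psi : formula R V,
    forall s s', (forall x, E (s x) (s' x)) -> `|eval s' phi - eval s psi| <= e) ->
  succ_saturated I M -> succ_saturated I N.
Proof.
move=> /choice[h Eh] /choice[g Eg] approx satM A AI G GA Gfin.
have /choice[F HF] (p : formula R W * nat) : exists psi : formula R V,
    forall s s', (forall x, E (s x) (s' x)) -> `|eval s' p.1 - eval s psi| <= p.2.+1%:R^-1.
  by apply: approx; rewrite invr_gt0 ltr0Sn.
(* The condition that [phi] is 0 becomes, for each [n], the condition that its approximation is at
   most 1/(n+1); parameters move to [M] along [g]. *)
pose up (q : pformula N * nat) : pformula M :=
  (near_cst_formula q.2.+1%:R^-1 0 (F (q.1.1, q.2)), fun x => omap g (q.1.2 x)).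
have HE (s : nat -> M) (s' : nat -> N) (e : nat -> option N) :
    (forall x, E (s x) (s' x)) ->
    forall x, E (odflt (s x) (omap g (e x))) (odflt (s' x) (e x)).
  by move=> ss' x; case: (e x) => [b|]; [exact: Eg|exact: ss'].
pose G' := up @` [set q | G q.1].
have [s Hs] : satisfiable G'.
  apply: (satM (g @` A)).
  - exact: card_le_trans (card_image_le _ _) AI.
  - move=> _ [q Gq <-] x a /=; case qx : (q.1.2 x) => [b|//] [<-].
    by exists b => //; apply: (GA _ Gq _ _ qx).
  - move=> K KG Kfin.
    (* The empty case is separate because [pre] below needs a default preimage [q0] for conditions
       outside [K]. *)
    have [[p0 Kp0]|K0] := pselect (K !=set0); last first.
      have [a] := univ_nonempty M; exists (fun=> a) => p Kp.
      by case: K0; exists p.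
    have [q0 _ _] := KG _ Kp0.
    have /choice[pre Hpre] p : exists q, K p -> G q.1 /\ up q = p.
      have [/KG[q Gq <-]|nKp] := pselect (K p); first by exists q.
      by exists q0.
    have preG : (fun p => (pre p).1) @` K `<=` G.
      by move=> _ [p Kp <-]; case: (Hpre p Kp).
    have [s' Hs'] := Gfin _ preG (finite_image _ Kfin).
    exists (fun x => g (s' x)) => p Kp; have [Gq <-] := Hpre p Kp.
    apply/eval_near_cst; rewrite subr0.
    have := Hs' _ (ex_intro2 _ _ _ Kp erefl).
    have := HF ((pre p).1.1, (pre p).2) _ _
      (HE _ _ (pre p).1.2 (fun x => Eg (s' x))).
    by rewrite /peval /= => + pK; rewrite pK sub0r normrN.
(* Two errors of at most 1/(n+1) add up: that of the approximation and that of its value at [s].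
   Choosing 1/(n+1) below [e / 2] bounds the value of [p] by any [e]. *)
exists (fun x => h (s x)) => p Gp; apply/eqP; rewrite -normr_le0.
apply/ler_addgt0Pr => e e0; rewrite add0r.
have [n _ Hn] := near_infty_natSinv_lt (PosNum (divr_gt0 e0 (ltr0Sn _ 1))).
have {}Hn := ltW (Hn n (leqnn n)).
have /eval_near_cst := Hs _ (imageP up (Gp : [set q | G q.1] (p, n))).
have := HF (p.1, n) _ _ (HE _ _ p.2 (fun x => Eh (s x))).
rewrite subr0 /peval /=.
set u := eval _ _; set v := eval _ _ => uv v0.
have := ler_distD v u 0; rewrite !subr0 => /le_trans; apply.
rewrite (splitr e); apply: lerD; [apply: le_trans uv _|apply: le_trans v0 _]; exact: Hn.
Qed.

End SaturationTransfer.

(** The correspondence is the graph of [red]; by [eval_red] each formula is its own exact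
    approximation. *)
Lemma succ_saturated_reduction (R : realType) (Sig : symbols) (V : vocabulary Sig)
    (I : Type) (M : structure R V) :
  succ_saturated I (reduction M) <-> succ_saturated I M.
Proof.
split.
  apply: (succ_saturated_transfer (E := fun q a => red a = q)) => [q|a|phi e e0].
  - by exists (unred q); exact: unredK.
  - by exists (red a).
  - exists phi => s s' ss'; rewrite -(eval_red s') (_ : (fun x => _) = s).
      by rewrite subrr normr0 ltW.
    by apply/funext => x.
apply: (succ_saturated_transfer (E := fun a q => red a = q)) => [a|q|phi e e0].
- by exists (red a).
- by exists (unred q); exact: unredK.
- exists phi => s s' ss'; rewrite -(eval_red s) (_ : (fun x => _) = s').
    by rewrite subrr normr0 ltW.
  by apply/funext => x.
Qed.

(** * Uniform limits of formulas, and completeness of the theory of a structure *)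

Section LimitFormulas.
Variables (R : realType) (Sig : symbols) (V : vocabulary Sig).

(** Pointwise limits exist because the reals are complete; letting [l] grow in the bound between
    [d k] and [d l], both within [e / 2] of [d m], makes the convergence uniform. *)
Lemma Cauchy_formulas_cvg (M : structure R V) (d : nat -> formula R V) (e : R) :
  Cauchy_formulas M d -> 0 < e -> exists m, forall k, (m <= k)%N ->
  forall s : nat -> M, `|lim_formulas d s - eval s (d k)| <= e.
Proof.
move=> dC e0.
have dist1 k l (s : nat -> M) : `| `|eval s (d k) - eval s (d l)| | <= 1.
  rewrite normr_id ler_distl.
  by have := eval01 s (d k); have := eval01 s (d l); lra.
have {}dC (e' : R) : 0 < e' -> exists m, forall k, (m <= k)%N -> forall s : nat -> M,
    `|eval s (d m) - eval s (d k)| <= e'.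
  move=> /dC[m Hm]; exists m => k mk s; apply: le_trans (Hm k mk).
  exact: (le_sup_range (f := fun s : nat -> M => `|eval s (d m) - eval s (d k)|)).
have cvgd (s : nat -> M) : (fun m => eval s (d m)) @ \oo --> lim_formulas d s.
  apply/cauchy_cvgP/cauchy_exP => e' e'0; have e'20 : 0 < e' / 2 by rewrite divr_gt0.
  have [m Hm] := dC _ e'20; exists (eval s (d m)); exists m => // k /= mk.
  by apply: le_lt_trans (Hm k mk s) _; lra.
have e20 : 0 < e / 2 by rewrite divr_gt0.
have [m Hm] := dC _ e20; exists m => k mk s; rewrite distrC.
apply: (cvgr_to_le (cvg_norm (cvgB (cvg_cst (eval s (d k))) (cvgd s)))).
exists m => // l /= ml; rewrite !fctE.
apply: le_trans (ler_distD (eval s (d m)) _ _) _.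
by rewrite (splitr e) lerD ?Hm // distrC Hm.
Qed.

Lemma lim_formulas01 (M : structure R V) (d : nat -> formula R V) (s : nat -> M) :
  Cauchy_formulas M d -> 0 <= lim_formulas d s <= 1.
Proof.
move=> dC; apply/andP; split; apply/ler_addgt0Pr => e e0;
  have [m /(_ m (leqnn m) s)] := Cauchy_formulas_cvg dC e0;
  by rewrite ler_distl; have := eval01 s (d m); lra.
Qed.

(** If [phi] has value r in [M], the sentence saying that [phi] is within 0 of r lies in [Th M],
    hence holds in [N] and forces r = 0. *)
Lemma Th_complete (M N : structure R V) phi :
  model (Th M) N -> sentence phi -> (forall s : nat -> N, eval s phi = 0) ->
  Th M phi.
Proof.
move=> MN phiS phi0; split=> // s; have [n] := univ_nonempty N.
have : Th M (near_cst_formula 0 (eval s phi) phi).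
  split=> [|s'].
    by rewrite /sentence /= bigcup_const //; exists ord0.
  apply/eval_near_cst; rewrite (_ : eval s' phi = eval s phi) ?subrr ?normr0 //.
  by apply: eval_fv => x; rewrite phiS.
move=> /MN/(_ (fun=> n))/eval_near_cst.
by rewrite phi0 sub0r normrN normr_le0 => /eqP.
Qed.

Lemma eval_Sup_eq0 (M : structure R V) (s : nat -> M) x psi :
  eval s (Sup x psi) = 0 <-> forall a, eval (upd s x a) psi = 0.
Proof.
split=> /= [sup0 a|psi0].
  apply/eqP; rewrite eq_le; apply/andP; split; last by case/andP: (eval01 (upd s x a) psi).
  rewrite -sup0; apply: (le_sup_range (f := fun a => eval (upd s x a) psi)) => b.
  exact: eval_norm.
rewrite (_ : _ @` _ = [set 0]) ?sup1 //; apply/seteqP; split=> [_ [a _ <-]|_ ->] //=.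
by have [a] := univ_nonempty M; exists a.
Qed.

Lemma upd_id (M : Type) (s : nat -> M) x : upd s x (s x) = s.
Proof. by apply/funext => y; rewrite /upd; case: eqP => [->|]. Qed.

End LimitFormulas.

(** * Comparing formulas and saturation over [V] and over [V] with [D] added *)

Section Reduct.
Variables (R : realType) (Sig : symbols) (V : vocabulary Sig) (D : psym Sig).
Hypothesis hD : psym_arity D = 2%N.
Let W := add_pred V D.

Fixpoint term_down (t : term W) : term V :=
  match t with
  | Var x => Var V x
  | Cst c => @Cst Sig V c
  | App f ts => @App Sig V f (fun i => term_down (ts i))
  end.

Fixpoint term_up (t : term V) : term W :=
  match t with
  | Var x => Var W x
  | Cst c => @Cst Sig W c
  | App f ts => @App Sig W f (fun i => term_up (ts i))
  end.

Fixpoint formula_up (phi : formula R V) : formula R W :=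
  match phi with
  | Atom P ts => @Atom R Sig W (old_pred D P) (fun i => term_up (ts i))
  | Conn n c phis => Conn c (fun i => formula_up (phis i))
  | Sup x psi => Sup x (formula_up psi)
  | Inf x psi => Inf x (formula_up psi)
  end.

Lemma term_eval_down (N : structure R W) (s : nat -> N) t :
  term_eval (M := reduct N) s (term_down t) = term_eval s t.
Proof.
elim: t => [x|c|f ts IH] //=.
by congr (fun_int (s := N) (f := f)); apply/funext => i; exact: IH.
Qed.

Lemma term_eval_up (N : structure R W) (s : nat -> N) t :
  term_eval s (term_up t) = term_eval (M := reduct N) s t.
Proof.
elim: t => [x|c|f ts IH] //=.
by congr (fun_int (s := N) (f := f)); apply/funext => i; exact: IH.
Qed.

Lemma eval_up (N : structure R W) (s : nat -> N) phi :
  eval s (formula_up phi) = eval (M := reduct N) s phi.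
Proof.
elim: phi s => [P ts|n c phis IH|x psi IH|x psi IH] s /=.
- by congr pred_int; apply/funext => i; exact: term_eval_up.
- by congr (conn c _); apply/rowP => i; rewrite !mxE; exact: IH.
- by congr (sup (_ @` _)); apply/funext => a; exact: IH.
- by congr (inf (_ @` _)); apply/funext => a; exact: IH.
Qed.

(** When [D] is already in [V], its old copy and the new symbol differ only in a boolean membership
    proof. *)
Lemma pred_int_reduct_new (N : structure R W) (h : D \in preds V) (a : 'I_(psym_arity D) -> N) :
  pred_int (s := reduct N) (P := exist _ D h) a = pred_int (P := new_pred V D) a.
Proof.
by rewrite /= /old_pred (bool_irrelevance (mem_add_pred D (exist _ D h) : D \in preds W) (mem_new_pred V D)).
Qed.

Lemma preds_add_predP (Q : preds W) :
  (exists P, Q = old_pred D P) \/ Q = new_pred V D.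
Proof.
case: Q => q qW; have [/mem_set qV|/= qD] := set_mem qW.
  by left; exists (exist _ q qV); exact: val_inj.
by right; apply: val_inj.
Qed.

(** The arity of [D] equals 2 only through [hD], so the indices 0 and 1 have to be cast. *)
Lemma pair_argsE (M : Type) (a : 'I_(psym_arity D) -> M) :
  a = pair_args (a (cast_ord (esym hD) ord0)) (a (cast_ord (esym hD) ord_max)).
Proof.
apply/funext => i; rewrite /pair_args; case: eqP => i0; congr a; apply: val_inj => //=.
have := ltn_ord i; rewrite [X in (_ < X)%N]hD.
by case: (nat_of_ord i) i0 => [|[|]].
Qed.

(* D(t_0, t_1) is the uniform limit of d_m(t_0, t_1); connectives preserve
   uniform approximation because they are uniformly continuous on the cube. *)
Lemma formula_approx (N : structure R W) (d : nat -> formula R V) :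
  (forall m, fv (d m) `<=` [set 0%N; 1%N]) ->
  Cauchy_formulas (reduct N) d -> is_lim_expansion d N ->
  forall (phi : formula R W) (e : R), 0 < e -> exists psi : formula R V,
    forall s : nat -> N, `|eval s phi - eval (M := reduct N) s psi| <= e.
Proof.
move=> d01 dC dN; have N0 := univ_nonempty N.
elim=> [Q ts|n c phis IH|x psi IH|x psi IH] e e0.
- have [[P QP]|QD] := preds_add_predP Q.
    subst Q; exists (@Atom R Sig V P (fun i => term_down (ts i))) => s /=.
    rewrite (_ : (fun i => term_eval s (ts i)) =
      (fun i => term_eval (M := reduct N) s (term_down (ts i)))).
      by rewrite subrr normr0 ltW.
    by apply/funext => i; rewrite term_eval_down.
  subst Q; have [m /(_ m (leqnn m)) Hm] := Cauchy_formulas_cvg dC e0.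
  pose t0 := term_down (ts (cast_ord (esym hD) ord0)).
  pose t1 := term_down (ts (cast_ord (esym hD) ord_max)).
  (* Variables 0 and 1 of [d m] receive the two arguments of the atom. *)
  have [psi Hpsi] := formula_subst (d m) (fun x => if x == 0%N then t0 else t1).
  exists psi => s; rewrite Hpsi; set s' := fun x => _.
  suff -> : eval s (Atom R ts) = lim_formulas (M := reduct N) d s' by exact: Hm.
  rewrite -dN /= (pair_argsE (fun i => term_eval s (ts i))).
  by rewrite /s' /= !term_eval_down.
- have [del del0 Hdel] := conn_unif_continuous c e0.
  have del20 : 0 < del / 2 by rewrite divr_gt0.
  have /choice[psis Hpsis] i := IH i _ del20.
  exists (Conn c psis) => s /=; apply/ltW/Hdel => [||i].
  + by apply: unit_cube_row => i; exact: eval01.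
  + by apply: unit_cube_row => i; exact: eval01.
  + by rewrite !mxE; apply: le_lt_trans (Hpsis i s) _; lra.
- have [psi' Hpsi] := IH e e0; exists (Sup x psi') => s /=.
  by apply: sup_range_dist => // a; exact: eval_norm.
- have [psi' Hpsi] := IH e e0; exists (Inf x psi') => s /=.
  by apply: inf_range_dist => // a; exact: eval_norm.
Qed.

Lemma succ_saturated_reduct (I : Type) (N : structure R W) :
  succ_saturated I N -> succ_saturated I (reduct N).
Proof.
apply: (succ_saturated_transfer (E := fun (a : N) (b : reduct N) => a = b)) => [a|a|phi e e0].
- by exists a.
- by exists a.
- exists (formula_up phi) => s s' /funext <-.
  by rewrite eval_up subrr normr0 ltW.
Qed.

(** Transfer along the identity of the common universe, with approximations from
    [formula_approx]. *)
Lemma succ_saturated_lim_expansion (I : Type) (N : structure R W) (d : nat -> formula R V) :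
  (forall m, fv (d m) `<=` [set 0%N; 1%N]) ->
  Cauchy_formulas (reduct N) d -> is_lim_expansion d N ->
  succ_saturated I (reduct N) -> succ_saturated I N.
Proof.
move=> d01 dC dN.
apply: (succ_saturated_transfer (E := fun (a : reduct N) (b : N) => a = b)) => [a|a|phi e e0].
- by exists a.
- by exists a.
- have [psi Hpsi] := formula_approx d01 dC dN phi e0.
  by exists psi => s s' /funext ->.
Qed.

(** * Expanding a [V]-structure by the limit predicate *)

Section Expansion.
Variables (M : structure R V) (m : M) (d : nat -> formula R V).

Definition assignment n (a : 'I_n -> M) (x : nat) : M :=
  if insub x is Some i then a i else m.

(** Symbols of [V], possibly including [D], keep their interpretation, so that the reduct is [M]
    again. [clamp] keeps the limit in [0, 1] for an arbitrary sequence and changes nothing for a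
    Cauchy one. *)
Definition exp_pred_int (Q : preds W) (a : 'I_(psym_arity (val Q)) -> M) : R :=
  match pselect (val Q \in preds V) with
  | left h => pred_int (P := exist _ (val Q) h) a
  | right _ => clamp (lim_formulas d (assignment a))
  end.

Lemma exp_pred_int01 (Q : preds W) a : 0 <= @exp_pred_int Q a <= 1.
Proof.
by rewrite /exp_pred_int; case: pselect => h; [exact: pred_int01|exact: clamp01].
Qed.

Definition expansion : structure R W :=
  @Structure R Sig W M (univ_nonempty M) (cst_int M)
    (fun f => @fun_int _ _ _ M f) exp_pred_int exp_pred_int01.

Lemma exp_pred_int_old (P : preds V) a : @exp_pred_int (old_pred D P) a = pred_int (P := P) a.
Proof.
case: P a => p hp a; rewrite /exp_pred_int; case: pselect => [h|//].
by rewrite (bool_irrelevance h hp).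
Qed.

End Expansion.

(** The statement on [eval] is proved along with the equality, which avoids transporting assignments
    between the two structures. *)
Lemma structure_ext (M : structure R V)
    (p : forall P : preds V, ('I_(psym_arity (val P)) -> M) -> R)
    (p01 : forall P a, 0 <= p P a <= 1) :
  (forall P a, p P a = pred_int a) ->
  let M' := Structure (univ_nonempty M) (cst_int M)
    (fun f => @fun_int _ _ _ M f) p01 in
  M' = M /\ forall (s : nat -> M) phi, eval (M := M') s phi = eval s phi.
Proof.
case: M p p01 => X X0 c f q q01 /= p p01 pq.
have {}pq : p = q by apply: functional_extensionality_dep => P; apply/funext => a.
by subst p; rewrite (Prop_irrelevance p01 q01).
Qed.

Lemma reduct_expansion (M : structure R V) (m : M) (d : nat -> formula R V) :
  reduct (expansion m d) = M /\
  forall (s : nat -> M) phi, eval (M := reduct (expansion m d)) s phi = eval s phi.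
Proof. by apply: structure_ext; exact: exp_pred_int_old. Qed.

(** If [D] is in [V], the hypothesis on the old interpretation decides; otherwise [clamp] disappears
    by [lim_formulas01], and only variables 0 and 1 affect the limit. *)
Lemma is_lim_expansion_expansion (M : structure R V) (m : M) (d : nat -> formula R V) :
  (forall k, fv (d k) `<=` [set 0%N; 1%N]) -> Cauchy_formulas M d ->
  (forall (h : D \in preds V) (s : nat -> M),
    pred_int (P := exist _ D h) (pair_args (s 0%N) (s 1%N)) = lim_formulas d s) ->
  is_lim_expansion d (expansion m d).
Proof.
move=> d01 dC DV s.
have -> : lim_formulas (M := reduct (expansion m d)) d s = lim_formulas (M := M) d s.
  rewrite /lim_formulas; under eq_fun do rewrite (reduct_expansion m d).2.
  by [].
rewrite /= /exp_pred_int; case: pselect => [h|_]; first exact: DV.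
rewrite /= (_ : lim_formulas d _ = lim_formulas (M := M) d s).
  have := lim_formulas01 (s : nat -> M) dC; rewrite /clamp => /andP[s0 s1].
  by rewrite min_r // max_r.
rewrite /lim_formulas (_ : (fun k => _) = fun k => eval (M := M) s (d k)) //.
apply/funext => k; apply: eval_fv => x /d01 x01; rewrite /assignment; case: insubP => /= [i _ ix|].
  by rewrite /pair_args ix; case: x01 => ->.
by rewrite hD; case: x01 => ->.
Qed.

End Reduct.

(* Relevant only when D already belongs to V. *)
Lemma pred_eq_lim (R : realType) (Sig : symbols) (V : vocabulary Sig) (D : psym Sig)
    (M0 M : structure R V) (N : structure R (add_pred V D)) (d : nat -> formula R V)
    (h : D \in preds V) (s : nat -> M) :
  (forall k, fv (d k) `<=` [set 0%N; 1%N]) ->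
  Cauchy_formulas M d -> Cauchy_formulas (reduct N) d ->
  model (Th M0) M -> model (Th M0) (reduct N) -> is_lim_expansion d N ->
  pred_int (P := exist _ D h) (pair_args (s 0%N) (s 1%N)) = lim_formulas d s.
Proof.
move=> d01 dM dN TM TN Nd.
pose ad : formula R V := @Atom R Sig V (exist _ D h) (pair_args (Var V 0) (Var V 1)).
have adE (K : structure R V) (s' : nat -> K) :
    eval s' ad = pred_int (P := exist _ D h) (pair_args (s' 0%N) (s' 1%N)).
  by rewrite /=; congr pred_int; apply/funext => i; rewrite /pair_args; case: ifP.
rewrite -adE; apply/eqP; rewrite -subr_eq0 -normr_le0.
apply/ler_addgt0Pr => e e0; rewrite add0r.
have e20 : 0 < e / 2 by rewrite divr_gt0.
have [m1 Hm1] := Cauchy_formulas_cvg dM e20.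
have [m2 Hm2] := Cauchy_formulas_cvg dN e20.
pose k := maxn m1 m2.
have {}Hm1 := Hm1 k (leq_maxl _ _) s; have {}Hm2 := Hm2 k (leq_maxr _ _).
(* [chi] says that [D] and [d k] differ by at most [e / 2] everywhere. It holds in the reduct of
   [N], where [D] is the limit, so it belongs to [Th M0] by completeness and passes to [M]. *)
pose chi := Sup 0 (Sup 1 (near_formula (e / 2) ad (d k))).
have chiT : Th M0 chi.
  apply: (Th_complete TN) => [|s'].
    rewrite /sentence -subset0 => x /= [[[i _ xi] x1] x0].
    case: ifP xi => _ => [[j _]|/d01[]//].
    by rewrite /pair_args; case: ifP => _.
  apply/eval_Sup_eq0 => a; apply/eval_Sup_eq0 => b; apply/eval_near.
  set s'' := upd _ _ _; have := Hm2 s''; rewrite -(Nd s'') adE.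
  by rewrite pred_int_reduct_new.
have : eval s chi = 0 by exact: TM.
move=> /eval_Sup_eq0/(_ (s 0%N))/eval_Sup_eq0/(_ (s 1%N)); rewrite upd_id upd_id.
move=> /eval_near Hs.
apply: le_trans (ler_distD (eval s (d k)) _ _) _.
by rewrite (splitr e) lerD // distrC.
Qed.

(* Equivalence of the two theories in the Keisler order *)
Local Close Scope ring_scope.

Theorem theorem5p8 (R : realType) (Sig : symbols) (V : vocabulary Sig)
    (D : psym Sig) (hD : psym_arity D = 2) (T : theory R V)
    (Te : theory R (add_pred V D)) :
  continuous_theory T -> premetric_expansion T Te -> Te ⊴ T /\ T ⊴ Te.
Proof.
move=> [M0 TE] [[L [_ [N0 [_ TeE]]]] [d [d01 dC TeP]]].
split=> I U [Ureg Usat]; split=> //.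
  move=> N NTe; have /TeP[NT _] := NTe.
  have /TeP[PT Pd] := model_preultrapower (U := U) NTe.
  apply/succ_saturated_reduction.
  apply: (succ_saturated_lim_expansion hD d01 (dC _ PT) Pd).
  (* The preultrapower of the reduct of [N] is, by conversion, the reduct of the preultrapower of
     [N]. *)
  have /succ_saturated_reduction satP := Usat _ NT.
  exact: satP.
move=> M MT; have [m] := univ_nonempty M.
(* [N0] is a model of [T] in which [D] is the limit; it is the reference structure for [pred_eq_lim]
   when [D] is in [V]. *)
have N0Te : model Te N0 by move=> phi; rewrite TeE => -[].
have /TeP[N0T N0d] := N0Te.
have NM : reduct (expansion D m d) = M by case: (reduct_expansion D m d).
have /TeP/Usat : model T (reduct (expansion D m d)) /\ is_lim_expansion d (expansion D m d).
  split; first by rewrite NM.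
  refine (is_lim_expansion_expansion hD (m := m) d01 (dC _ MT) _) => h s.
  subst T; apply: (pred_eq_lim (M0 := M0) (N := N0)) => //; exact: dC.
move=> /succ_saturated_reduction/succ_saturated_reduct satP.
rewrite -NM; exact/succ_saturated_reduction.
Qed.
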